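(* Let $g$ be a piecewise $D$-finite function on $[a,b]$ with $K\ge 0$ jump points $\xi_1<\dots<\xi_K$ in $(a,b)$, all of whose pieces are annihilated by one differential operator of order $N$ (see context). Let $\mathfrak{D}=\sum_{j=0}^{N}p_j(x)\partial^j$, $p_j(x)=\sum_{i=0}^{k_j}a_{i,j}x^i$, be the operator annihilating $g$: if $K=0$, $\mathfrak{D}g\equiv0$ on $[a,b]$ in the usual sense; if $K>0$, $\mathfrak{D}=\prod_{i=1}^{K}(x-\xi_i)^N\,\mathfrak{D}^{\dagger}$ where $\mathfrak{D}^{\dagger}$ (of order $N$) annihilates every piece of $g$ (so that $\mathfrak{D}$ annihilates $g$ as a distribution). Let $m_k=\int_a^b x^kg(x)\,dx$, and let $v^{(i,j)}_k$, $h_j(z)$ and $\mathfrak{g}_j$ be as in the context. Then: (A) For every $\widehat M\in\mathbb{N}$ the vector $\mathbf{a}=(a_{0,0},a_{1,0},\dots,a_{k_0,0},a_{0,1},\dots,a_{k_N,N})^T$ satisfies the homogeneous linear system $H\mathbf{a}=0$, where $H$ is the matrix with rows indexed by $k=0,1,\dots,\widehat M$ and columns indexed by the pairs $(i,j)$, $0\le j\le N$, $0\le i\le k_j$ (in the same order as the entries of $\mathbf{a}$), whose $(k,(i,j))$ entry is $v^{(i,j)}_k$. (B) $v^{(i,j)}_k=m_{i+k}(\mathfrak{g}_j)$ for all $0\le j\le N$, $0\le i\le k_j$ and $k\ge 0$. Consequently, $h_j(z)$ is the moment generating function of $\mathfrak{g}_j$, i.e. $h_j(z)=\sum_{k\ge0}m_k(\mathfrak{g}_j)z^k$.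 (C) The formal power series $1,h_0(z),\dots,h_N(z)$ are polynomially dependent: $$q(z)+\sum_{j=0}^{N}h_j(z)\,p_j^*(z)=0,$$ where $p_j^*(z)=z^{\max_l k_l}\,p_j(z^{-1})$ and $q(z)$ is a polynomial with $\deg q<\max_l k_l$.
   Context: Setting. $-\infty<a=\xi_0<\xi_1<\dots<\xi_{K+1}=b<\infty$, $\Delta_n=[\xi_n,\xi_{n+1}]$; $g:[a,b]\to\mathbb{R}$ equals $g_n\in C^N(\Delta_n)$ on $\Delta_n$ (values at jump points being irrelevant), $0\le n\le K$. There is one differential operator of order $N\ge1$ with real polynomial coefficients (called $\mathfrak{D}$ if $K=0$ and $\mathfrak{D}^\dagger$ if $K>0$) whose leading coefficient does not vanish on $[a,b]$ and which annihilates every $g_n$ on $\Delta_n$. Notation. $\partial=d/dx$. $\mathrm{E}$ is the shift on sequences indexed by $k\ge0$: $\mathrm{E}s_k=s_{k+1}$; $\mathrm{I}$ is the identity. $(x)_j=x(x-1)\cdots(x-j+1)$, $(x)_0=1$. Set $$\mathcal{E}(\mathrm{E})=(\mathrm{E}-a\mathrm{I})^N(\mathrm{E}-b\mathrm{I})^N,\qquad \Pi^{(i,j)}(k,\mathrm{E})=(-1)^j(i+k)_j\,\mathrm{E}^{i-j},$$ where $\Pi^{(i,j)}$ sends $\{m_k\}$ to the sequence with $k$-th term $(-1)^j(i+k)_j\,m_{i+k-j}$ (read as $0$ if $i+k<j$). Products are compositions, rightmost applied first. Then $$v^{(i,j)}_k=\bigl(\mathcal{E}(\mathrm{E})\cdot\Pi^{(i,j)}(k,\mathrm{E})\bigr)m_k,\qquad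 h_j(z)=\sum_{k=0}^{\infty}v^{(0,j)}_kz^k,\qquad \mathfrak{g}_j(x)=(x-a)^N(x-b)^N\,\frac{d^j}{dx^j}g(x).$$ If $K>0$, derivatives of $g$ are distributional derivatives on the open interval $(a,b)$; $\frac{d^j}{dx^j}g$ (and its multiples by polynomials) is then the sum of an ordinary piecewise smooth function $r$ and finitely many terms $c\,\delta^{(l)}(x-\xi_i)$, $l\le N-1$, $1\le i\le K$. The pairing of such a distribution with $f\in C^{N-1}([a,b])$ is $\int_a^b rf\,dx$ plus the corresponding terms $(-1)^l c\,f^{(l)}(\xi_i)$, and its moments are $m_k(\cdot)=\langle\,\cdot\,,x^k\rangle$. For integrable functions $m_k(f)=\int_a^bx^kf(x)\,dx$. The degree of the zero polynomial is $-\infty$. *)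

(* Defs.v *)
From HB Require Import structures.
From mathcomp Require Export all_boot all_order all_algebra.
From mathcomp Require Export all_classical all_reals all_analysis.
Export Order.TTheory GRing.Theory Num.Theory numFieldNormedType.Exports.

Set Implicit Arguments.
Unset Strict Implicit.
Unset Printing Implicit Defensive.

Local Open Scope classical_set_scope.
Local Open Scope ring_scope.

Section ClosedIntervalDerivatives.
Context {R : realType}.
Implicit Types (c d : R) (f : R -> R).

Definition diff_quot f (x y : R) : R := (f y - f x) / (y - x).

(* Derivative relative to [c, d]: one-sided at the two end points.            *)
Definition derivI c d f : R -> R :=
  fun x => lim (diff_quot f x y @[y --> within `[c, d] x^']).

Definition derivIn c d (j : nat) f : R -> R := iter j (derivI c d) f.

Definition CnI (n : nat) c d f : Prop :=
  (forall (j : nat) (x : R), (j < n)%N -> x \in `[c, d] ->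
     cvg (diff_quot (derivIn c d j f) x y @[y --> within `[c, d] x^']))
  /\ {within `[c, d], continuous (derivIn c d n f)}.

(* The operator with coefficients p 0, ..., p N annihilates f on [c, d].      *)
Definition annihilates_on (N : nat) (p : 'I_N.+1 -> {poly R}) c d f : Prop :=
  forall x : R, x \in `[c, d] ->
    \sum_(j < N.+1) (p j).[x] * derivIn c d j f x = 0.

End ClosedIntervalDerivatives.

(* Break points are xi 0 < ... < xi K.+1, with a = xi 0 and b = xi K.+1; the  *)
(* jump points are xi 1, ..., xi K. Values of xi beyond K.+1 are never used.  *)
Section Breakpoints.
Context {R : realType}.
Implicit Types (xi : nat -> R) (K N : nat).

Definition pieced K xi (g : R -> R) (gp : nat -> R -> R) : Prop :=
  forall (n : nat) (x : R), (n <= K)%N -> x \in `[xi n, xi n.+1] ->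
    (forall i, (1 <= i <= K)%N -> x != xi i) -> g x = gp n x.

Definition jump_factor N K xi : {poly R} :=
  \prod_(1 <= i < K.+1) ('X - (xi i)%:P) ^+ N.

Definition end_factor N (a b : R) : {poly R} :=
  ('X - a%:P) ^+ N * ('X - b%:P) ^+ N.

Definition fun_moment (a b : R) (f : R -> R) (k : nat) : R :=
  \int[lebesgue_measure]_(x in `[a, b]) (x ^+ k * f x).

End Breakpoints.

Section Distributions.
Context {R : realType}.

Definition test_fun (a b : R) (phi : R -> R) : Prop :=
  (forall (n : nat) (x : R), derivable (derive1n n phi) x 1) /\
  (exists c d : R,
     [/\ a < c, d < b & forall x : R, x \notin `[c, d] -> phi x = 0]).

(* Distributions on the open interval ]a, b[ are represented by functionals   *)
(* of which only the values on test functions matter.                         *)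
Definition functional := (R -> R) -> R.

Definition distr_of_fun (a b : R) (g : R -> R) : functional :=
  fun phi => \int[lebesgue_measure]_(x in `[a, b]) (g x * phi x).

Definition distr_deriv (T : functional) : functional :=
  fun phi => - T (derive1 phi).

Definition distr_scale (p : {poly R}) (T : functional) : functional :=
  fun phi => T (fun x => p.[x] * phi x).

Definition pw_continuous (K : nat) (xi : nat -> R) (r : R -> R) : Prop :=
  forall n : nat, (n <= K)%N ->
    exists2 s : R -> R, {within `[xi n, xi n.+1], continuous s} &
      forall x : R, x \in `]xi n, xi n.+1[ -> r x = s x.

(* Pairing of r + \sum_(i, l) c i l * delta^(l)(x - xi i.+1) with f.          *)
Definition pairing (N K : nat) (xi : nat -> R)
    (r : R -> R) (c : 'I_K -> 'I_N -> R) : functional :=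
  fun f => \int[lebesgue_measure]_(x in `[xi 0%N, xi K.+1]) (r x * f x)
         + \sum_(i < K) \sum_(l < N) (-1) ^+ l * c i l * derive1n l f (xi i.+1).

Definition decomposes (N K : nat) (xi : nat -> R) (T : functional)
    (r : R -> R) (c : 'I_K -> 'I_N -> R) : Prop :=
  pw_continuous K xi r /\
  forall phi, test_fun (xi 0%N) (xi K.+1) phi -> T phi = pairing xi r c phi.

(* The moment of T is read off a decomposition of T; the decomposition of a   *)
(* distribution on ]a, b[ is unique up to a null set, and x ^+ k (which is    *)
(* not a test function) is paired with it on the whole of [a, b].             *)
Definition distr_moment (N K : nat) (xi : nat -> R) (T : functional)
    (k : nat) : R :=
  xget 0 [set mu : R | exists (r : R -> R) (c : 'I_K -> 'I_N -> R),
    decomposes xi T r c /\ mu = pairing xi r c (fun x => x ^+ k)].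

Definition gfrak_distr (N K : nat) (xi : nat -> R) (g : R -> R) (j : nat) :
    functional :=
  distr_scale (end_factor N (xi 0%N) (xi K.+1))
    (iter j distr_deriv (distr_of_fun (xi 0%N) (xi K.+1) g)).

Definition gfrak_fun (N : nat) (a b : R) (g : R -> R) (j : nat) : R -> R :=
  fun x => (end_factor N a b).[x] * derivIn a b j g x.

(* k-th moment of (x - a)^N (x - b)^N g^(j); derivatives of g are classical   *)
(* on [a, b] when there is no jump, distributional on ]a, b[ otherwise.       *)
Definition gfrak_moment (N K : nat) (xi : nat -> R) (g : R -> R)
    (j k : nat) : R :=
  if K == 0%N then
    fun_moment (xi 0%N) (xi K.+1) (gfrak_fun N (xi 0%N) (xi K.+1) g j) k
  else distr_moment N K xi (gfrak_distr N K xi g j) k.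

End Distributions.

Section Sequences.
Context {R : realType}.
Implicit Types (s m : nat -> R).

Definition shift s : nat -> R := fun k => s k.+1.

Definition shift_sub (c : R) s : nat -> R := fun k => shift s k - c * s k.

(* (E - a I)^N (E - b I)^N                                                    *)
Definition opE (N : nat) (a b : R) s : nat -> R :=
  iter N (shift_sub a) (iter N (shift_sub b) s).

(* When i + k < j the falling factorial vanishes, hence so does the term.     *)
Definition opPi (i j : nat) m : nat -> R :=
  fun k => (-1) ^+ j * ((i + k) ^_ j)%:R * m (i + k - j)%N.

Definition vseq (N : nat) (a b : R) m (i j : nat) : nat -> R :=
  opE N a b (opPi i j m).

End Sequences.

(* A formal power series is the sequence of its coefficients.                 *)
Section FormalPowerSeries.
Context {R : realType}.

Definition fps := nat -> R.

Definition fps_mul (f h : fps) : fps :=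
  fun n => \sum_(i < n.+1) f i * h (n - i)%N.

Definition fps_poly (p : {poly R}) : fps := fun n => p`_n.

(* z^d p(z^-1), for p of degree at most e with e <= d.                        *)
Definition revpoly (d e : nat) (p : {poly R}) : {poly R} :=
  \sum_(i < e.+1) p`_i *: 'X^(d - i).

End FormalPowerSeries.

(* Main.v *)
(* Let E = (x - a)^N (x - b)^N and let <g^(j), q> = (-1)^j int_a^b g q^(j) for
   smooth q. Multiplying the j-th derivative of the moment functional by E
   shows v^(i,j)_k = <g^(j), E x^(i+k)>. Integrating by parts on each piece
   turns <g^(j), E phi> into the integral of the piecewise derivative of order
   j against E phi plus boundary terms at the break points; those at a and b
   vanish since E has zeros of order N there, and those at the jump points are
   combinations of phi^(l)(xi_i), l < N, i.e. the delta terms of the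
   distribution. The formula holds for every smooth phi, so that it gives both
   a decomposition of the distribution (phi a test function) and its moments
   (phi = x^k); smooth cutoffs tending to 1 show that the moments do not depend
   on the decomposition, which is (B). For phi = p_j x^k the boundary terms
   vanish at the jump points too, because of the factor prod (x - xi_i)^N of
   p_j, and summing over j gives (A); the coefficient of z^n in (C) is row
   n - d of (A) for n >= d = max k_l. *)
Require Import Defs.
From mathcomp Require Import ring zify measurable_realfun.

Local Open Scope classical_set_scope.
Local Open Scope ring_scope.

(** * Smooth functions *)

Section Smooth.
Context {R : realType}.
Implicit Types (f g : R -> R) (n : nat).

(** The finite-order form of [smooth] supports induction on the order: the derivative of a product
    or of an inverse involves the original functions again, with one order less to establish. *)
Definition derivable_upto n f : Prop :=
  forall k x, (k < n)%N -> derivable (derive1n k f) x 1.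

Definition smooth f : Prop := forall n x, derivable (derive1n n f) x 1.

Lemma smoothP f : smooth f <-> forall n, derivable_upto n f.
Proof. by split=> [sf n k x _|df n x]; [exact: sf|exact: (df n.+1)]. Qed.

Lemma derivable_upto0 f : derivable_upto 0 f.
Proof. by move=> k x; rewrite ltn0. Qed.

Lemma derivable_uptoS n f :
  derivable_upto n.+1 f <->
  (forall x, derivable f x 1) /\ derivable_upto n (derive1 f).
Proof.
split=> [df|[df df'] [|k] x kn].
- by split=> [x|k x kn]; [exact: (df 0%N)|rewrite -derive1Sn; exact: df].
- exact: df.
- by rewrite derive1Sn; exact: df'.
Qed.

Lemma derivable_uptoW n f : derivable_upto n.+1 f -> derivable_upto n f.
Proof. by move=> df k x kn; apply: df; exact: leqW. Qed.

Lemma smooth_derive1n n f : smooth f -> smooth (derive1n n f).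
Proof. by move=> sf k x; rewrite /derive1n -iterD; exact: sf. Qed.

Lemma smooth_derive1 f : smooth f -> smooth (derive1 f).
Proof. exact: (@smooth_derive1n 1%N). Qed.

Lemma smooth_derivable f : smooth f -> forall x, derivable f x 1.
Proof. by move=> sf x; exact: (sf 0%N). Qed.

Lemma derivable_continuous1 f : (forall x, derivable f x 1) -> continuous f.
Proof.
by move=> df x; apply/differentiable_continuous/derivable1_diffP; exact: df.
Qed.

Lemma smooth_continuous f n : smooth f -> continuous (derive1n n f).
Proof. by move=> sf; apply: derivable_continuous1 => x; exact: sf. Qed.

Lemma derive1_mul f g : (forall x, derivable f x 1) ->
  (forall x, derivable g x 1) ->
  derive1 (fun x => f x * g x) = fun x => derive1 f x * g x + f x * derive1 g x.
Proof.
move=> df dg; apply/funext => x.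
rewrite !derive1E (deriveM (df x) (dg x)).
by rewrite addrC; congr (_ + _); rewrite /GRing.scale/= mulrC.
Qed.

Lemma derive1_add f g : (forall x, derivable f x 1) ->
  (forall x, derivable g x 1) ->
  derive1 (fun x => f x + g x) = fun x => derive1 f x + derive1 g x.
Proof.
by move=> df dg; apply/funext => x; rewrite !derive1E (deriveD (df x) (dg x)).
Qed.

Lemma derive1n_add n f g : smooth f -> smooth g ->
  derive1n n (fun x => f x + g x) = fun x => derive1n n f x + derive1n n g x.
Proof.
elim: n f g => [//|n IH] f g sf sg.
rewrite !derive1Sn derive1_add; [|exact: smooth_derivable..].
exact: IH (smooth_derive1 _ sf) (smooth_derive1 _ sg).
Qed.

Lemma derivable_upto_add n f g : derivable_upto n f -> derivable_upto n g ->
  derivable_upto n (fun x => f x + g x).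
Proof.
elim: n f g => [|n IH] f g; first by move=> _ _; exact: derivable_upto0.
move=> /derivable_uptoS[df df'] /derivable_uptoS[dg dg'].
apply/derivable_uptoS; split=> [x|]; first exact: derivableD.
by rewrite (derive1_add _ _ df dg); exact: IH.
Qed.

Lemma derivable_upto_mul n f g : derivable_upto n f -> derivable_upto n g ->
  derivable_upto n (fun x => f x * g x).
Proof.
elim: n f g => [|n IH] f g sf sg; first exact: derivable_upto0.
have /derivable_uptoS[df df'] := sf; have /derivable_uptoS[dg dg'] := sg.
apply/derivable_uptoS; split=> [x|]; first exact: derivableM.
rewrite (derive1_mul _ _ df dg); apply: derivable_upto_add.
- exact: IH df' (derivable_uptoW _ _ sg).
- exact: IH (derivable_uptoW _ _ sf) dg'.
Qed.

Lemma derive1n_horner n (p : {poly R}) :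
  derive1n n (horner p) = horner (p^`(n))%R.
Proof. by elim: n => [//|n IH]; rewrite derive1nS IH derivnS derivE. Qed.

Lemma smooth_horner (p : {poly R}) : smooth (horner p).
Proof. by move=> n x; rewrite derive1n_horner; exact: derivable_horner. Qed.

Lemma smooth_cst (c : R) : smooth (fun=> c).
Proof. by have := smooth_horner c%:P; rewrite hornerC_ext. Qed.

(** The derivative [- f' / f^2] is a product of two copies of the inverse and [- f'], so the order
    below suffices for it. *)
Lemma derivable_upto_inv n f : (forall x, f x != 0) ->
  derivable_upto n f -> derivable_upto n (fun x => (f x)^-1).
Proof.
move=> f0; elim: n => [|n IH] sf; first exact: derivable_upto0.
have /derivable_uptoS[df df'] := sf.
have iVf := IH (derivable_uptoW _ _ sf).
apply/derivable_uptoS; split=> [x|]; first exact: derivableV.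
have -> : derive1 (fun x => (f x)^-1) =
    fun x => (f x)^-1 * ((f x)^-1 * (0 - derive1 f x)).
  apply/funext => x; rewrite !derive1E deriveV//.
  by rewrite -exprVn /GRing.scale/= expr2 sub0r mulrA mulrN mulNr.
do 2 apply: (derivable_upto_mul _ _ _ iVf).
have -> : (fun x => 0 - derive1 f x) = (fun x => (-1) * derive1 f x).
  by apply/funext => x; rewrite sub0r mulN1r.
apply: (derivable_upto_mul _ _ _ _ df') => k x _.
by have := smooth_cst (-1); apply.
Qed.

Lemma smooth_mul f g : smooth f -> smooth g -> smooth (fun x => f x * g x).
Proof. by rewrite !smoothP => sf sg n; exact: derivable_upto_mul. Qed.

Lemma smooth_add f g : smooth f -> smooth g -> smooth (fun x => f x + g x).
Proof. by rewrite !smoothP => sf sg n; exact: derivable_upto_add. Qed.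

Lemma smooth_inv f : (forall x, f x != 0) -> smooth f ->
  smooth (fun x => (f x)^-1).
Proof. by rewrite !smoothP => f0 sf n; exact: derivable_upto_inv. Qed.

Lemma derive1_affine f (c d : R) : (forall x, derivable f x 1) ->
  derive1 (fun x => f (c * x + d)) = fun x => c * derive1 f (c * x + d).
Proof.
move=> df; apply/funext => x.
have dA y : derivable (fun x : R => c * x + d) y 1.
  have -> : (fun x : R => c * x + d) = horner (c *: 'X + d%:P).
    by apply/funext => z; rewrite !hornerE.
  exact: derivable_horner.
have -> : (fun x => f (c * x + d)) = f \o (fun x => c * x + d) by [].
rewrite derive1_comp; [|exact: dA|exact: df].
rewrite /= mulrC; congr (_ * _).
have -> : (fun x : R => c * x + d) = horner (c *: 'X + d%:P).
  by apply/funext => z; rewrite !hornerE.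
by rewrite -derivE derivD derivZ derivX derivC !hornerE.
Qed.

Lemma derivable_affine f (c d : R) x : (forall x, derivable f x 1) ->
  derivable (fun x => f (c * x + d)) x 1.
Proof.
move=> df; apply/derivable1_diffP.
apply: (@differentiable_comp _ _ _ _ (fun x => c * x + d) f); last first.
  exact/derivable1_diffP.
apply/derivable1_diffP.
have -> : (fun x : R => c * x + d) = horner (c *: 'X + d%:P).
  by apply/funext => z; rewrite !hornerE.
exact: derivable_horner.
Qed.

Lemma smooth_affine f (c d : R) : smooth f -> smooth (fun x => f (c * x + d)).
Proof.
rewrite !smoothP => + n.
elim: n f => [|n IH] f sf; first exact: derivable_upto0.
have /derivable_uptoS[df _] := sf 1%N.
apply/derivable_uptoS; split=> [x|]; first exact: derivable_affine.
rewrite (derive1_affine _ _ _ df); apply: derivable_upto_mul.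
  by move=> k x _; exact: smooth_cst.
by apply: IH => k; case: (derivable_uptoS k f) => + _ => /(_ (sf k.+1))[].
Qed.

End Smooth.

(** * A smooth step *)

Section FlatFunctions.
Context {R : realType}.
Implicit Types p : {poly R}.

(** Induction on [p] with [n] free: in [p * 'X + c] the factor ['X] is absorbed into the power of
    [y], and the constant term is controlled by the bound of [y^n] by a factorial times [expR y]. *)
Lemma poly_expRN_bounded p n :
  exists C : R, forall y : R, 0 <= y -> `|p.[y] * y ^+ n * expR (- y)| <= C.
Proof.
elim/poly_ind: p n => [|p c IH] n.
  by exists 0 => y _; rewrite horner0 !mul0r normr0.
have [C pC] := IH n.+1; exists (C + `|c| * n.+1`!%:R) => y y0.
have -> : (p * 'X + c%:P).[y] * y ^+ n * expR (- y) =
    p.[y] * y ^+ n.+1 * expR (- y) + c * (y ^+ n * expR (- y)).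
  by rewrite hornerMXaddC exprS; ring.
apply: (le_trans (ler_normD _ _)); apply: lerD; first exact: pC.
rewrite normrM ler_wpM2l// ger0_norm ?mulr_ge0 ?exprn_ge0 ?expR_ge0//.
rewrite expRN ler_pdivrMr ?expR_gt0//.
case: n {pC} => [|n].
  by rewrite expr0 mul1r -expR0 ler_expR.
rewrite (@le_trans _ _ (n.+1`!%:R * expR y))//.
  rewrite -ler_pdivrMl ?ltr0n ?fact_gt0// mulrC.
  by apply: le_trans (expR_ge1Dxn n y0); rewrite lerDr.
by rewrite ler_wpM2r ?expR_ge0// ler_nat [leqRHS]factS leq_pmull.
Qed.

(* p = 1 gives the classical flat function exp (- 1 / x). *)
Definition flat p (x : R) : R := if 0 < x then p.[x^-1] * expR (- x^-1) else 0.

(* d/dx (p(1/x) e^(-1/x)) = (p - p')(1/x) / x^2 e^(-1/x): the family is closed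
   under differentiation. *)
Lemma is_derive_flat p (x : R) :
  is_derive x (1 : R) (flat p) (flat ((p - p^`()) * 'X^2) x).
Proof.
have [x0|x0|->] := ltgtP x 0.
- rewrite [X in is_derive _ _ _ X]/flat ltNge (ltW x0)/=.
  apply: (@near_eq_is_derive _ _ _ (cst 0)).
  near=> y; rewrite /flat ltNge (_ : y <= 0)//= ltW//.
  by near: y; exact: lt_nbhsl.
- have -> : flat ((p - p^`()) * 'X^2) x =
      (p.[x^-1] *: (expR (- x^-1) * - 1) + expR (- x^-1) *: p^`().[x^-1])
      * (- x ^- 2 *: 1).
    rewrite /flat x0 !hornerE /GRing.scale/= -exprVn; ring.
  apply: (@near_eq_is_derive _ _ _
    ((horner p * (expR \o -%R)) \o (fun x => x^-1))).
    near=> y; rewrite /flat (_ : 0 < y)//.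
    by near: y; exact: lt_nbhsr.
  apply: is_derive1_comp; last exact: is_deriveV (lt0r_neq0 x0) _.
  exact: is_deriveM.
- rewrite [X in is_derive _ _ _ X]/flat ltxx.
  (* With [y = 1 / h], the difference quotient at 0 for [h > 0] is [h] times [p(y) y^2 exp(-y)]. The
     second factor is bounded, so the quotient tends to 0. *)
  have [C pC] := poly_expRN_bounded p 2.
  have cvg0 : h^-1 *: (flat p (h *: 1 + 0) - flat p 0)
      @[h --> 0^'] --> (0 : R).
    apply/cvgrPdist_le => e e0; near=> h.
    rewrite sub0r normrN addr0 /flat ltxx subr0.
    rewrite [h *: 1]mulr1 /GRing.scale/=.
    case: ifPn => [h0|_]; last by rewrite mulr0 normr0 ltW.
    have -> : h^-1 * (p.[h^-1] * expR (- h^-1)) =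
        h * (p.[h^-1] * h^-1 ^+ 2 * expR (- h^-1)).
      by field; rewrite gt_eqF.
    have C1 : 0 < `|C| + 1 by rewrite ltr_wpDl.
    apply: (@le_trans _ _ (`|h| * (`|C| + 1))).
      rewrite normrM ler_wpM2l//; apply: (@le_trans _ _ C).
        by apply: pC; rewrite invr_ge0 ltW.
      by apply: (le_trans (ler_norm C)); rewrite lerDl.
    rewrite -ler_pdivlMr//; near: h; apply: dnbhs0_le.
    by rewrite divr_gt0.
  apply: DeriveDef; first by apply/cvg_ex; exists 0.
  exact: cvg_lim cvg0.
Unshelve. all: by end_near. Qed.

Lemma derive1_flat p : derive1 (flat p) = flat ((p - p^`()) * 'X^2).
Proof. by apply/funext => x; rewrite derive1E; case: (is_derive_flat p x). Qed.

Lemma smooth_flat p : smooth (flat p).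
Proof.
move=> n; elim: n p => [|n IH] p x; first by case: (is_derive_flat p x).
by rewrite derive1Sn derive1_flat.
Qed.

(** A transition from 0 to 1 across the unit interval. One of [x] and [1 - x] is always positive, so
    the denominator never vanishes. *)
Definition smooth_step (x : R) : R := flat 1 x / (flat 1 x + flat 1 (1 - x)).

Lemma flat1_ge0 x : 0 <= flat 1 x.
Proof. by rewrite /flat; case: ifP => // _; rewrite hornerC mul1r expR_ge0. Qed.

Lemma flat1_gt0 x : 0 < x -> 0 < flat 1 x.
Proof. by rewrite /flat => ->; rewrite hornerC mul1r expR_gt0. Qed.

Lemma flat1_eq0 x : x <= 0 -> flat 1 x = 0.
Proof. by rewrite /flat ltNge => ->. Qed.

Lemma smooth_step_den_gt0 x : 0 < flat 1 x + flat 1 (1 - x).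
Proof.
have [x0|x0] := ltP 0 x; first by rewrite ltr_pwDl ?flat1_gt0 ?flat1_ge0.
by rewrite ltr_wpDl ?flat1_ge0// flat1_gt0// subr_gt0 (le_lt_trans x0).
Qed.

Lemma smooth_smooth_step : smooth smooth_step.
Proof.
apply: smooth_mul; first exact: smooth_flat.
apply: smooth_inv => [x|]; first by rewrite gt_eqF ?smooth_step_den_gt0.
apply: smooth_add; first exact: smooth_flat.
have := smooth_affine _ (-1) 1 (smooth_flat 1).
by under eq_fun do rewrite mulN1r addrC.
Qed.

Lemma smooth_step_le0 x : x <= 0 -> smooth_step x = 0.
Proof. by move=> x0; rewrite /smooth_step flat1_eq0// mul0r. Qed.

Lemma smooth_step_ge1 x : 1 <= x -> smooth_step x = 1.
Proof.
move=> x1; rewrite /smooth_step [X in _ / (_ + X)]flat1_eq0 ?subr_le0// addr0.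
by rewrite divff// gt_eqF// flat1_gt0// (lt_le_trans _ x1).
Qed.

Lemma smooth_step_ge0 x : 0 <= smooth_step x.
Proof. by rewrite divr_ge0 ?flat1_ge0// ltW ?smooth_step_den_gt0. Qed.

Lemma smooth_step_le1 x : smooth_step x <= 1.
Proof.
by rewrite ler_pdivrMr ?smooth_step_den_gt0// mul1r lerDl flat1_ge0.
Qed.

End FlatFunctions.

(** * Integration by parts on a closed interval *)

Section DerivIExtensionality.
Context {R : realType}.

Lemma eq_derivI (c d : R) (f h : R -> R) :
  (forall x, x \in `[c, d] -> f x = h x) ->
  forall x, x \in `[c, d] -> derivI c d f x = derivI c d h x.
Proof.
move=> fh x xcd; rewrite /derivI; congr (lim _).
have FF : Filter (within `[c, d] x^') by exact: within_filter.
rewrite eqEsubset; split; apply: near_eq_cvg; rewrite near_withinE;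
  by near=> y => ycd; rewrite /diff_quot !fh.
Unshelve. all: by end_near. Qed.

Lemma eq_derivIn (c d : R) j (f h : R -> R) :
  (forall x, x \in `[c, d] -> f x = h x) ->
  forall x, x \in `[c, d] -> derivIn c d j f x = derivIn c d j h x.
Proof.
move=> fh; elim: j => [//|j IH] x xcd.
exact: eq_derivI.
Qed.

End DerivIExtensionality.

Section ClosedIntervalCalculus.
Context {R : realType}.
Implicit Types (c d : R) (f phi : R -> R).
Notation mu := (@lebesgue_measure R).

(** Follows from [f y = f x + diff_quot f x y * (y - x)]. This only controls the punctured
    neighbourhood, so the point [y = x] is added afterwards. *)
Lemma cvg_diff_quot_continuous c d f x : x \in `[c, d] ->
  cvg (diff_quot f x y @[y --> within `[c, d] x^']) ->
  f y @[y --> within `[c, d] (nbhs x)] --> f x.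
Proof.
move=> xcd /cvg_ex[l fl].
have fx : f y @[y --> within `[c, d] x^'] --> f x.
  have FF : Filter (within `[c, d] x^') by exact: within_filter.
  have idx : y - x @[y --> within `[c, d] x^'] --> x - x.
    apply: cvgB; last exact: (@cvg_cst R x).
    by move=> P Px; apply: filterS (nbhs_dnbhs Px) => y Py _.
  have := cvgD (cvg_cst (f x)) (cvgM fl idx).
  rewrite subrr mulr0 addr0 => /(_ FF FF FF) H.
  apply: (cvg_trans _ H); apply: near_eq_cvg.
  rewrite near_withinE near_withinE; near=> y => yx _.
  transitivity (f x + (f y - f x) / (y - x) * (y - x)); first by [].
  by rewrite divfK ?subr_eq0// addrC subrK.
move=> P Px.
have H : \forall y \near x, y != x -> y \in `[c, d] -> P (f y) := fx P Px.
suff : \forall y \near x, y \in `[c, d] -> P (f y) by [].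
apply: filterS H => y Py ycd.
have [->|yx] := eqVneq y x; first exact: nbhs_singleton.
exact: Py.
Unshelve. all: by end_near. Qed.

Lemma within_continuousM c d (f h : R -> R) :
  {within `[c, d], continuous f} -> continuous h ->
  {within `[c, d], continuous (fun x => f x * h x)}.
Proof.
move=> cf ch x; apply: continuousM; first exact: cf.
exact: continuous_subspaceT.
Qed.

Lemma CnI_derivIn_continuous (n : nat) c d f (j : nat) :
  CnI n c d f -> (j <= n)%N -> {within `[c, d], continuous (derivIn c d j f)}.
Proof.
move=> [df cf]; rewrite leq_eqVlt => /predU1P[->//|jn].
apply/subspace_continuousP => x xcd.
by apply: cvg_diff_quot_continuous => //; exact: df.
Qed.

Lemma is_derive_derivI c d f x : x \in `]c, d[ ->
  cvg (diff_quot f x y @[y --> within `[c, d] x^']) ->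
  is_derive x (1 : R) f (derivI c d f x).
Proof.
move=> xcd fx.
(* The usual derivative is a limit in the increment [h]. As [x] is interior, [h + x] stays in the
   interval for small [h], so the restriction in the relative limit is invisible. *)
have shx : (h + x)%R @[h --> (0 : R)^'] --> within `[c, d] x^'.
  move=> P; rewrite /fmap/= /within/= => -[e /= e0 eP].
  have [r /= r0 rcd] := near_in_itvoo xcd.
  exists (Num.min e r); first by rewrite /= lt_min e0.
  move=> h /=; rewrite sub0r normrN lt_min => /andP[he hr] h0.
  apply: eP => /=.
  - by rewrite opprD addrCA subrr addr0 normrN.
  - by rewrite -subr_eq0 addrK.
  - apply: subset_itv_oo_cc; apply: rcd => /=.
    by rewrite opprD addrCA subrr addr0 normrN.
have H : h^-1 *: (f (h *: 1 + x) - f x) @[h --> (0 : R)^'] --> derivI c d f x.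
  apply: (cvg_trans _ (cvg_comp _ _ shx fx)); apply: near_eq_cvg.
  near=> h; rewrite /diff_quot /= addrK mulrC.
  by rewrite [h *: 1]mulr1.
by apply: DeriveDef; [apply/cvg_ex; exists (derivI c d f x)|exact: cvg_lim H].
Unshelve. all: by end_near. Qed.

Lemma CnI_is_derive (n : nat) c d f (j : nat) x :
  CnI n c d f -> (j < n)%N -> x \in `]c, d[ ->
  is_derive x (1 : R) (derivIn c d j f) (derivIn c d j.+1 f x).
Proof.
move=> [df _] jn xcd; apply: is_derive_derivI => //.
by apply: df => //; exact: subset_itv_oo_cc.
Qed.

Lemma CnI_derivable_oo_LRcontinuous (n : nat) c d f (j : nat) : c < d ->
  CnI n c d f -> (j < n)%N -> derivable_oo_LRcontinuous (derivIn c d j f) c d.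
Proof.
move=> cd fn jn.
have /(continuous_within_itvP _ cd)[_ fc fd] :=
  CnI_derivIn_continuous _ _ _ _ _ fn (ltnW jn).
by split=> // x xcd; case: (CnI_is_derive _ _ _ _ _ _ fn jn xcd).
Qed.

Lemma smooth_derivable_oo_LRcontinuous c d phi n :
  smooth phi -> derivable_oo_LRcontinuous (derive1n n phi) c d.
Proof.
move=> sphi; split=> [x _||]; first exact: sphi.
  exact/cvg_at_right_filter/smooth_continuous.
exact/cvg_at_left_filter/smooth_continuous.
Qed.

Lemma CnI_integration_by_parts (n : nat) c d f (s t : nat) phi : c < d ->
  CnI n c d f -> smooth phi -> (s < n)%N ->
  \int[mu]_(x in `[c, d]) (derivIn c d s f x * derive1n t.+1 phi x) =
  (derivIn c d s f d * derive1n t phi d - derivIn c d s f c * derive1n t phi c)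
  - \int[mu]_(x in `[c, d]) (derivIn c d s.+1 f x * derive1n t phi x).
Proof.
move=> cd fn sphi sn; apply: Rintegration_by_parts => //.
- exact: (CnI_derivIn_continuous _ _ _ _ _ fn).
- exact: CnI_derivable_oo_LRcontinuous fn sn.
- move=> x xcd; rewrite derive1E.
  by case: (CnI_is_derive _ _ _ _ _ _ fn sn xcd).
- by apply: continuous_subspaceT; exact: smooth_continuous.
- exact: smooth_derivable_oo_LRcontinuous.
Qed.

(* Boundary terms of a j-fold integration by parts moving all the derivatives
   from phi to f. *)
Definition bdry c d f (j : nat) phi (x : R) : R :=
  \sum_(l < j) (-1) ^+ l.+1 * derivIn c d (j.-1 - l) f x * derive1n l phi x.

Lemma CnI_iter_integration_by_parts (n : nat) c d f (j : nat) phi : c < d ->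
  CnI n c d f -> smooth phi -> (j <= n)%N ->
  (-1) ^+ j * \int[mu]_(x in `[c, d]) (f x * derive1n j phi x) =
  \int[mu]_(x in `[c, d]) (derivIn c d j f x * phi x)
  + (bdry c d f j phi d - bdry c d f j phi c).
Proof.
move=> cd fn sphi.
(* Here [s] derivatives already sit on [f] and [t] remain on [phi]. Each integration by parts
   preserves [s + t], which makes induction on [t] possible. *)
suff H t s : (s + t <= n)%N ->
    (-1) ^+ t * \int[mu]_(x in `[c, d]) (derivIn c d s f x * derive1n t phi x) =
    \int[mu]_(x in `[c, d]) (derivIn c d (s + t) f x * phi x)
    + \sum_(l < t) (-1) ^+ l.+1 *
        (derivIn c d ((s + t).-1 - l) f d * derive1n l phi d
         - derivIn c d ((s + t).-1 - l) f c * derive1n l phi c).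
  move=> jn; have := H j 0%N jn; rewrite add0n => ->; congr (_ + _).
  rewrite /bdry -sumrB; apply: eq_bigr => l _; ring.
elim: t s => [|t IH] s stn.
  by rewrite expr0 mul1r addn0 big_ord0 addr0.
rewrite (CnI_integration_by_parts n)//; last first.
  by apply: leq_trans stn; rewrite -addn1 leq_add2l.
rewrite mulrBr [X in _ - X](_ : _ = - ((-1) ^+ t *
  \int[mu]_(x in `[c, d]) (derivIn c d s.+1 f x * derive1n t phi x))); last
  first.
  by rewrite exprS mulN1r mulNr.
rewrite IH ?addSnnS// opprK big_ord_recr/=.
have -> : ((s + t.+1).-1 - t = s)%N by rewrite addnS addnK.
ring.
Qed.

End ClosedIntervalCalculus.

(** * Integrals over pieces *)

Section RintegralSum.
Context {d} {T : measurableType d} {R : realType}.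
Variable mu : {measure set T -> \bar R}.

(** Integrability of the sum is proved together with the formula because the inductive step for the
    latter requires it. *)
Lemma Rintegral_sum (D : set T) n (F : 'I_n -> T -> R) : measurable D ->
  (forall i, mu.-integrable D (EFin \o F i)) ->
  mu.-integrable D (EFin \o (fun x => \sum_(i < n) F i x)) /\
  \int[mu]_(x in D) (\sum_(i < n) F i x) = \sum_(i < n) \int[mu]_(x in D) F i x.
Proof.
move=> mD; elim: n F => [|n IH] F iF.
  rewrite big_ord0 (_ : (fun x => _) = cst 0).
    by split; [exact: integrable0|rewrite Rintegral_cst// mul0r].
  by apply/funext => x; rewrite big_ord0.
have [iS eS] := IH (fun i => F (lift ord0 i)) (fun i => iF _).
rewrite big_ord_recl -eS -RintegralD//.
rewrite (_ : (fun x => _) = fun x => F ord0 x + \sum_(i < n) F (lift ord0 i) x).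
  split=> //; have := integrableD mD (iF ord0) iS.
  by apply: eq_integrable => // x _; rewrite /= EFinD.
by apply/funext => x; rewrite big_ord_recl.
Qed.

End RintegralSum.

Section PiecewiseIntegral.
Context {R : realType}.
Implicit Types (c d : R) (f : R -> R).
Notation mu := (@lebesgue_measure R).

(** The two end points form a null set, so the values of [f] there, such as those of [g] at its
    jumps, affect neither integrability nor the integral. *)
Lemma integrable_itvoo_eq c d (f s : R -> R) : c < d ->
  {within `[c, d], continuous s} -> (forall x, x \in `]c, d[ -> f x = s x) ->
  mu.-integrable `[c, d] (EFin \o f) /\
  \int[mu]_(x in `[c, d]) f x = \int[mu]_(x in `[c, d]) s x.
Proof.
move=> cd cs fs.
have is_ : mu.-integrable `[c, d] (EFin \o s).
  apply: continuous_compact_integrable => //; exact: segment_compact.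
have iso : mu.-integrable `]c, d[ (EFin \o s).
  by apply: integrableS is_ => //; exact: subset_itv_oo_cc.
have ifo : mu.-integrable `]c, d[ (EFin \o f).
  by apply: eq_integrable iso => // x; rewrite inE/= => xcd; rewrite fs.
have mfo := measurable_int mu ifo.
have if_ : mu.-integrable `[c, d] (EFin \o f).
  apply/integrableP; split; first exact: emeasurable_fun_itv_cc mfo.
  rewrite integral_itv_bndoo; last exact: measurableT_comp.
  by have /integrableP[] := ifo.
split=> //; rewrite /Rintegral; congr fine.
rewrite integral_itv_bndoo// [RHS]integral_itv_bndoo; last first.
  exact: measurable_int iso.
by apply: eq_integral => x; rewrite inE/= => xcd; rewrite fs.
Qed.

Lemma integrable_setU (A B : set R) (f : R -> \bar R) :
  measurable A -> measurable B -> [disjoint A & B] ->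
  mu.-integrable A f -> mu.-integrable B f -> mu.-integrable (A `|` B) f.
Proof.
move=> mA mB AB /integrableP[mfA iA] /integrableP[mfB iB].
have mf : measurable_fun (A `|` B) f by apply/measurable_funU.
apply/integrableP; split => //.
rewrite ge0_integral_setU//; last exact: measurableT_comp.
exact: lte_add_pinfty.
Qed.

Lemma integral_pieces (K : nat) (xi : nat -> R) (f : R -> R)
    (s : nat -> R -> R) :
  (forall n, (n <= K)%N -> xi n < xi n.+1) ->
  (forall n, (n <= K)%N -> {within `[xi n, xi n.+1], continuous (s n)}) ->
  (forall n x, (n <= K)%N -> x \in `]xi n, xi n.+1[ -> f x = s n x) ->
  mu.-integrable `[xi 0%N, xi K.+1] (EFin \o f) /\
  \int[mu]_(x in `[xi 0%N, xi K.+1]) f x =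
  \sum_(n < K.+1) \int[mu]_(x in `[xi n, xi n.+1]) s n x.
Proof.
move=> lt cs fs.
suff H n : (n <= K)%N -> xi 0%N < xi n.+1 /\
  mu.-integrable `[xi 0%N, xi n.+1] (EFin \o f) /\
  \int[mu]_(x in `[xi 0%N, xi n.+1]) f x =
  \sum_(i < n.+1) \int[mu]_(x in `[xi i, xi i.+1]) s i x.
  by case: (H K (leqnn K)).
elim: n => [|n IH] nK.
  split; first exact: lt.
  have [if_ e] := integrable_itvoo_eq _ _ _ _ 
    (lt _ nK) (cs _ nK) (fun x => fs _ x nK).
  by rewrite big_ord_recl big_ord0 addr0.
have [lt0 [if_ e]] := IH (ltnW nK).
have [ifn en] := integrable_itvoo_eq _ _ _ _ 
    (lt _ nK) (cs _ nK) (fun x => fs _ x nK).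
(* The new piece is taken open on the left so that the union is disjoint; closing it again at the
   end leaves its integral unchanged. *)
have ifn' : mu.-integrable `]xi n.+1, xi n.+2] (EFin \o f).
  by apply: integrableS ifn => //; exact: subset_itv_oc_cc.
have U : `[xi 0%N, xi n.+2]%classic =
    `[xi 0%N, xi n.+1] `|` `]xi n.+1, xi n.+2].
  by apply: itv_bndbnd_setU; rewrite bnd_simp ltW// lt.
have D : [disjoint `[xi 0%N, xi n.+1]%classic & `]xi n.+1, xi n.+2]%classic].
  apply/disj_setPS => x [] /=; rewrite !in_itv/= => /andP[_ h] /andP[h' _].
  by have := lt_le_trans h' h; rewrite ltxx.
have ifU : mu.-integrable `[xi 0%N, xi n.+2] (EFin \o f).
  by rewrite U; exact: integrable_setU.
split; first exact: lt_trans lt0 (lt _ nK).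
split=> //; rewrite U Rintegral_setU -?U// big_ord_recr/= -e; congr (_ + _).
by rewrite Rintegral_itv_obnd_cbnd.
Qed.

End PiecewiseIntegral.

(** * Boundary terms and decomposition of the distributional derivatives *)

Section Jets.
Context {R : realType}.
Implicit Types (L : (R -> R) -> R) (p : {poly R}) (phi : R -> R).

(** Such an [L] acts as a distribution supported at [x] of order below [n]. One family of
    coefficients serves all [phi], which is what allows them to become coefficients of delta
    terms. *)
Definition jet (n : nat) (x : R) L : Prop :=
  exists c : nat -> R, forall phi, smooth phi ->
    L phi = \sum_(s < n) c s * derive1n s phi x.

Lemma jetW n k x L : (n <= k)%N -> jet n x L -> jet k x L.
Proof.
move=> nk [c Lc]; exists (fun s => if (s < n)%N then c s else 0) => phi sphi.
rewrite Lc// (big_ord_widen _ (fun s => c s * derive1n s phi x) nk).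
by rewrite big_mkcond/=; apply: eq_bigr => s _; case: ifP => //; rewrite mul0r.
Qed.

Lemma jet_add n x L1 L2 : jet n x L1 -> jet n x L2 ->
  jet n x (fun phi => L1 phi + L2 phi).
Proof.
move=> [c1 h1] [c2 h2]; exists (fun s => c1 s + c2 s) => phi sphi.
by rewrite h1// h2// -big_split/=; apply: eq_bigr => s _; rewrite mulrDl.
Qed.

Lemma jet_scale n x a L : jet n x L -> jet n x (fun phi => a * L phi).
Proof.
move=> [c h]; exists (fun s => a * c s) => phi sphi.
by rewrite h// mulr_sumr; apply: eq_bigr => s _; rewrite mulrA.
Qed.

Lemma jet_sum n x m (L : 'I_m -> (R -> R) -> R) : (forall i, jet n x (L i)) ->
  jet n x (fun phi => \sum_(i < m) L i phi).
Proof.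
move=> /choice[c h]; exists (fun s => \sum_(i < m) c i s) => phi sphi.
under eq_bigr do rewrite h//.
rewrite exchange_big/=; apply: eq_bigr => s _; rewrite mulr_suml.
exact: eq_bigr.
Qed.

Lemma jet_derive1 n x L : jet n x L -> jet n.+1 x (fun phi => L (derive1 phi)).
Proof.
move=> [c h]; exists (fun s => if s is s'.+1 then c s' else 0) => phi sphi.
rewrite h; last exact: smooth_derive1.
rewrite big_ord_recl mul0r add0r; apply: eq_bigr => s _.
by rewrite -derive1Sn.
Qed.

Lemma smooth_poly_mul p phi : smooth phi -> smooth (fun x => p.[x] * phi x).
Proof. by apply: smooth_mul; exact: smooth_horner. Qed.

Lemma derive1n_poly_mulS n p phi : smooth phi ->
  derive1n n.+1 (fun x => p.[x] * phi x) =
  fun x => derive1n n (fun x => p^`().[x] * phi x) x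
         + derive1n n (fun x => p.[x] * derive1 phi x) x.
Proof.
move=> sphi; rewrite derive1Sn (derive1_mul (horner p) phi).
- rewrite -derivE; apply: derive1n_add; first exact: smooth_poly_mul.
  by apply: smooth_poly_mul; exact: smooth_derive1.
- by move=> x; exact: derivable_horner.
- exact: smooth_derivable.
Qed.

(** The Leibniz rule with implicit coefficients: one derivative falls either on [p] or on [phi], and
    both resulting terms are jets by induction. *)
Lemma jet_derive1n_poly_mul n p x :
  jet n.+1 x (fun phi => derive1n n (fun y => p.[y] * phi y) x).
Proof.
elim: n p => [|n IH] p.
  by exists (fun=> p.[x]) => phi _; rewrite big_ord1.
have [c h] := jet_add _ _ _ _ (jetW _ _ _ _ (leqnSn n.+1) (IH p^`()))
  (jet_derive1 _ _ _ (IH p)).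
by exists c => phi sphi; rewrite derive1n_poly_mulS// -h.
Qed.

(** Differentiating [p] lowers the order of its root at [c] by at most one, so fewer than [n]
    derivatives cannot exhaust a root of order [n]. *)
Lemma derive1n_poly_mul_root n l (c : R) p phi : (l < n)%N ->
  ('X - c%:P) ^+ n %| p -> smooth phi ->
  derive1n l (fun x => p.[x] * phi x) c = 0.
Proof.
elim: l n p phi => [|l IH] [//|n] p phi ln cp sphi.
  have := dvdp_trans (dvdp_exp2l ('X - c%:P) ln) cp.
  by rewrite expr1 dvdp_XsubCl => /rootP cp0; rewrite /derive1n/= cp0 mul0r.
have cp' : ('X - c%:P) ^+ n %| p^`().
  have /dvdpP[q ->] := cp.
  rewrite derivM deriv_exp derivXsubC mul1r dvdp_add//.
    by rewrite dvdp_mull// dvdp_exp2l.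
  by rewrite dvdp_mull// -mulr_natl dvdp_mull.
have cpn : ('X - c%:P) ^+ n %| p.
  by apply: dvdp_trans cp; rewrite dvdp_exp2l.
rewrite (derive1n_poly_mulS _ _ _ sphi) (IH n _ _ ln cp' sphi).
by rewrite (IH n _ _ ln cpn (smooth_derive1 _ sphi)) addr0.
Qed.

End Jets.

(** * Integration by parts on all pieces and the resulting jump terms *)

Section Pieces.
Context {R : realType}.
Variables (N K : nat) (xi : nat -> R) (g : R -> R) (gp : nat -> R -> R).
Hypothesis xi_lt : forall n : nat, (n <= K)%N -> xi n < xi n.+1.
Hypothesis g_pieces : pieced K xi g gp.
Hypothesis gp_CN : forall n : nat, (n <= K)%N -> CnI N (xi n) (xi n.+1) (gp n).
Notation mu := (@lebesgue_measure R).
Let a := xi 0%N.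
Let b := xi K.+1.

Lemma xi_le i n : (i <= n <= K.+1)%N -> xi i <= xi n.
Proof.
elim: n => [|n IH] /andP[]; first by rewrite leqn0 => /eqP->.
rewrite leq_eqVlt => /predU1P[->//|]; rewrite !ltnS => i_n nK.
by rewrite (le_trans (IH _)) ?i_n 1?leqW// ltW// xi_lt.
Qed.

Lemma xi_piece_disj i n x : (i <= K)%N -> (n <= K)%N ->
  x \in `]xi n, xi n.+1[ -> x \in `]xi i, xi i.+1[ -> i = n.
Proof.
move=> iK nK; rewrite !in_itv/= => /andP[nx xn] /andP[ix xi'].
have [||//] := ltngtP i n => h.
- have /(lt_le_trans xi') : xi i.+1 <= xi n by rewrite xi_le// h ltnW.
  by move=> /(lt_trans nx); rewrite ltxx.
- have /(lt_le_trans xn) : xi n.+1 <= xi i by rewrite xi_le// h ltnW.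
  by move=> /(lt_trans ix); rewrite ltxx.
Qed.

Lemma g_eq_gp n x : (n <= K)%N -> x \in `]xi n, xi n.+1[ -> g x = gp n x.
Proof.
move=> nK xn; apply: g_pieces => //; first exact: subset_itv_oo_cc.
move=> i /andP[i1 iK]; move: xn; rewrite in_itv/= => /andP[nx xn].
have [i_n|n_i] := leqP i n.
  by rewrite gt_eqF// (le_lt_trans _ nx)// xi_le// i_n ltnW.
by rewrite lt_eqF// (lt_le_trans xn)// xi_le// n_i ltnW.
Qed.

Lemma gp_continuous n j : (n <= K)%N -> (j <= N)%N ->
  {within `[xi n, xi n.+1], continuous (derivIn (xi n) (xi n.+1) j (gp n))}.
Proof. by move=> nK jN; exact: CnI_derivIn_continuous (gp_CN _ nK) jN. Qed.

Lemma integrable_g_mul (h : R -> R) : continuous h ->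
  mu.-integrable `[a, b] (EFin \o (fun x => g x * h x)).
Proof.
move=> ch; apply: (proj1 (integral_pieces _ _ _
  (fun n x => gp n x * h x) xi_lt _ _)).
- move=> n nK; apply: within_continuousM => //.
  exact: (gp_continuous _ 0%N nK).
- by move=> n x nK xn; rewrite (g_eq_gp _ _ nK xn).
Qed.

(** The boundary terms are grouped by piece here and include those at [a] and [b]; [jump_terms_jets]
    regroups them by break point. *)
Definition jump_terms (j : nat) (phi : R -> R) : R :=
  \sum_(n < K.+1) (bdry (xi n) (xi n.+1) (gp n) j phi (xi n.+1)
                 - bdry (xi n) (xi n.+1) (gp n) j phi (xi n)).

Lemma pieces_integration_by_parts j phi : (j <= N)%N -> smooth phi ->
  (-1) ^+ j * \int[mu]_(x in `[a, b]) (g x * derive1n j phi x) =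
  \sum_(n < K.+1) \int[mu]_(x in `[xi n, xi n.+1])
    (derivIn (xi n) (xi n.+1) j (gp n) x * phi x) + jump_terms j phi.
Proof.
move=> jN sphi.
have cphi := smooth_continuous _ j sphi.
rewrite (proj2 (integral_pieces _ _ _
  (fun n x => gp n x * derive1n j phi x) xi_lt _ _)); first last.
- by move=> n x nK xn; rewrite (g_eq_gp _ _ nK xn).
- move=> n nK; apply: within_continuousM => //.
  exact: (gp_continuous _ 0%N nK).
rewrite mulr_sumr -big_split/=; apply: eq_bigr => n _.
have nK : (n <= K)%N by rewrite -ltnS.
exact: (CnI_iter_integration_by_parts _ _ _ _ _ _ (xi_lt _ nK) (gp_CN _ nK)).
Qed.

Lemma bdry_eq0 (c d : R) f j (p : {poly R}) phi x : (j <= N)%N -> smooth phi ->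
  ('X - x%:P) ^+ N %| p -> bdry c d f j (fun y => p.[y] * phi y) x = 0.
Proof.
move=> jN sphi px; rewrite /bdry big1// => l _.
rewrite (derive1n_poly_mul_root N) ?mulr0//.
exact: leq_trans (ltn_ord l) jN.
Qed.

Lemma jump_terms_eq0 j (p : {poly R}) phi : (j <= N)%N -> smooth phi ->
  (forall n, (n <= K.+1)%N -> ('X - (xi n)%:P) ^+ N %| p) ->
  jump_terms j (fun x => p.[x] * phi x) = 0.
Proof.
move=> jN sphi pxi; rewrite /jump_terms big1// => n _.
have nK : (n <= K)%N by rewrite -ltnS.
by rewrite !bdry_eq0 ?subrr//; apply: pxi => //; exact: leqW.
Qed.

Lemma jet_bdry (c d : R) f j (p : {poly R}) x : (j <= N)%N ->
  jet N x (fun phi => bdry c d f j (fun y => p.[y] * phi y) x).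
Proof.
move=> jN; apply: jet_sum => l; apply: jet_scale.
apply: jetW (jet_derive1n_poly_mul _ _ _).
exact: leq_trans (ltn_ord l) jN.
Qed.

(** Each jump point collects the right end of one piece and the left end of the next, both jets of
    order [N]. The two terms left over, at [a] and [b], vanish by the roots of [p]. *)
Lemma jump_terms_jets j (p : {poly R}) : (j <= N)%N ->
  ('X - a%:P) ^+ N %| p -> ('X - b%:P) ^+ N %| p ->
  exists c : 'I_K -> 'I_N -> R, forall phi, smooth phi ->
    jump_terms j (fun x => p.[x] * phi x) =
    \sum_(i < K) \sum_(l < N) (-1) ^+ l * c i l * derive1n l phi (xi i.+1).
Proof.
move=> jN pa pb.
pose J (i : 'I_K) phi := 1 *
    bdry (xi i) (xi i.+1) (gp i) j (fun y => p.[y] * phi y) (xi i.+1)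
  + (-1) * bdry (xi i.+1) (xi i.+2) (gp i.+1) j
      (fun y => p.[y] * phi y) (xi i.+1).
have /choice[c Jc] : forall i, exists c : nat -> R, forall phi, smooth phi ->
    J i phi = \sum_(s < N) c s * derive1n s phi (xi i.+1).
  by move=> i; apply: jet_add; apply: jet_scale; exact: jet_bdry.
(* The sign in the witness cancels the sign [(-1)^l] with which [delta^(l)] acts. *)
exists (fun i l => (-1) ^+ l * c i l) => phi sphi.
rewrite /jump_terms sumrB big_ord_recr [X in _ - X]big_ord_recl/=.
rewrite [X in _ + X - _]bdry_eq0// [X in _ - (X + _)]bdry_eq0//.
rewrite addr0 add0r -sumrB.
apply: eq_bigr => i _.
rewrite (_ : _ - _ = J i phi); last by rewrite /J mul1r mulN1r.
rewrite Jc//; apply: eq_bigr => l _; congr (_ * _).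
by rewrite mulrA -expr2 -exprM mulnC exprM sqrrN expr1n expr1n mul1r.
Qed.

(** The open pieces are disjoint, so at most one summand is nonzero. At the break points the value
    is a harmless default 0. *)
Definition glue (s : nat -> R -> R) (x : R) : R :=
  \sum_(n < K.+1) if x \in `]xi n, xi n.+1[ then s n x else 0.

Lemma glueE s n x : (n <= K)%N -> x \in `]xi n, xi n.+1[ -> glue s x = s n x.
Proof.
move=> nK xn; rewrite /glue (bigD1 (Ordinal (nK : n < K.+1)%N))//= xn.
rewrite big1 ?addr0// => i; rewrite -val_eqE/=; case: ifP => // xi_ /eqP[].
by apply: xi_piece_disj xn xi_ => //; rewrite -ltnS.
Qed.

(** The ordinary part glues [E] times the piecewise derivatives, and the jump terms supply the
    deltas. Allowing every smooth [phi] lets the same [r] and [c] serve test functions and monomials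
    alike. *)
Lemma gfrak_decomposition j : (j <= N)%N ->
  exists (r : R -> R) (c : 'I_K -> 'I_N -> R), pw_continuous K xi r /\
  forall phi, smooth phi ->
    (-1) ^+ j * \int[mu]_(x in `[a, b])
      (g x * derive1n j (fun x => (end_factor N a b).[x] * phi x) x)
    = pairing xi r c phi.
Proof.
move=> jN; set E := end_factor N a b.
have [c h] := jump_terms_jets j E jN (dvdp_mulIl _ _) (dvdp_mulIr _ _).
pose s n x := derivIn (xi n) (xi n.+1) j (gp n) x * E.[x].
have cs n : (n <= K)%N -> {within `[xi n, xi n.+1], continuous (s n)}.
  move=> nK; apply: within_continuousM; first exact: gp_continuous.
  exact: continuous_horner.
exists (glue s), c; split.
  by move=> n nK; exists (s n); [exact: cs|move=> x xn; exact: glueE].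
move=> phi sphi.
rewrite (pieces_integration_by_parts _ _ jN (smooth_poly_mul _ _ sphi)).
rewrite h// /pairing; congr (_ + _).
rewrite (proj2 (integral_pieces _ _ _ (fun n x => s n x * phi x) xi_lt _ _)).
- by apply: eq_bigr => n _; apply: eq_Rintegral => x _; rewrite mulrA.
- move=> n nK; apply: within_continuousM; first exact: cs.
  exact: (smooth_continuous _ 0%N sphi).
- by move=> n x nK xn; rewrite (glueE _ _ _ nK xn).
Qed.

End Pieces.

(** * Cutoffs *)

Section Cutoff.
Context {R : realType}.
Variables (a b : R).
Notation mu := (@lebesgue_measure R).

(** Vanishes outside the interval and within [1 / (n+1)] of its end points, and equals 1 at points
    inside at distance at least [2 / (n+1)] from both. *)
Definition cutoff (n : nat) (x : R) : R :=
  smooth_step (n.+1%:R * (x - a) - 1) * smooth_step (n.+1%:R * (b - x) - 1).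

Lemma smooth_cutoff n : smooth (cutoff n).
Proof.
apply: smooth_mul.
- have := smooth_affine smooth_step n.+1%:R (- n.+1%:R * a - 1)
    smooth_smooth_step.
  by congr smooth; apply/funext => x; congr smooth_step; ring.
- have := smooth_affine smooth_step (- n.+1%:R) (n.+1%:R * b - 1)
    smooth_smooth_step.
  by congr smooth; apply/funext => x; congr smooth_step; ring.
Qed.

Lemma cutoff_norm n x : `|cutoff n x| <= 1.
Proof.
rewrite ger0_norm; last by apply: mulr_ge0; exact: smooth_step_ge0.
by apply: mulr_ile1; rewrite ?smooth_step_ge0 ?smooth_step_le1.
Qed.

Lemma test_fun_cutoff n phi : smooth phi ->
  test_fun a b (fun x => phi x * cutoff n x).
Proof.
move=> sphi; split; first exact: smooth_mul sphi (smooth_cutoff n).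
have n0 : 0 < n.+1%:R^-1 :> R by rewrite invr_gt0 ltr0n.
(* For small [n] this interval may be empty; the cutoff is then identically 0. *)
exists (a + n.+1%:R^-1), (b - n.+1%:R^-1); split.
- by rewrite ltrDl.
- by rewrite gtrBl.
move=> x; rewrite in_itv/= negb_and -!ltNge => /orP[xa|xb].
  rewrite /cutoff smooth_step_le0 ?mul0r ?mulr0// subr_le0.
  by rewrite -ler_pdivlMl ?ltr0n// mulr1 lerBlDl ltW.
rewrite /cutoff (smooth_step_le0 (_ * (b - x) - 1)) ?mulr0// subr_le0.
by rewrite -ler_pdivlMl ?ltr0n// mulr1 lerBlDr -lerBlDl ltW.
Qed.

Lemma cutoff_eq1 c d : a < c -> d < b ->
  \forall n \near \oo, forall x, x \in `[c, d] -> cutoff n x = 1.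
Proof.
move=> ac db.
(* Half the distance from [[c, d]] to the end points: once [1 / (n+1)] is below it, both steps have
   reached 1 on [[c, d]]. *)
have e0 : 0 < Num.min (c - a) (b - d) / 2.
  by rewrite divr_gt0 ?lt_min ?subr_gt0 ?ac.
near=> n => x; rewrite in_itv/= => /andP[cx xd].
have nn : n.+1%:R^-1 < Num.min (c - a) (b - d) / 2.
  by near: n; exact: (near_infty_natSinv_lt (PosNum e0)).
have {}nn : 2 < n.+1%:R * Num.min (c - a) (b - d).
  by rewrite mulrC -ltr_pdivrMr ?ltr0n// mulrC -ltr_pdivlMr// mulrC.
have H y : Num.min (c - a) (b - d) <= y ->
    smooth_step (n.+1%:R * y - 1) = 1.
  move=> hy; apply: smooth_step_ge1; rewrite lerBrDr ltW//.
  by rewrite (lt_le_trans nn)// ler_wpM2l.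
rewrite /cutoff (H (x - a)) ?(H (b - x)) ?mulr1// ge_min.
- by rewrite [X in _ || X]lerD2l lerN2 xd orbT.
- by rewrite lerD2r cx.
Unshelve. all: by end_near. Qed.

Lemma eq_derive1n_itvoo l (f h : R -> R) c d :
  (forall x, x \in `]c, d[ -> f x = h x) ->
  forall x, x \in `]c, d[ -> derive1n l f x = derive1n l h x.
Proof.
move=> fh; elim: l => [//|l IH] x xcd.
rewrite !derive1nS !derive1E; apply: near_eq_derive.
by near=> y; apply: IH; near: y; exact: near_in_itvoo.
Unshelve. all: by end_near. Qed.

(** The cutoffs are eventually 1 on a whole neighbourhood of [x], so derivatives at [x] become
    exact, not merely convergent. This carries the delta terms to the limit. *)
Lemma derive1n_cutoff l phi x : a < x -> x < b ->
  \forall n \near \oo,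
    derive1n l (fun y => phi y * cutoff n y) x = derive1n l phi x.
Proof.
move=> ax xb.
have [c /andP[ac cx]] : exists c, a < c < x.
  by exists ((a + x) / 2); rewrite !midf_lt.
have [d /andP[xd db]] : exists d, x < d < b.
  by exists ((x + b) / 2); rewrite !midf_lt.
near=> n.
apply: (eq_derive1n_itvoo _ _ _ c d); last by rewrite in_itv/= cx.
move=> y ycd; have -> : cutoff n y = 1; last by rewrite mulr1.
move: (y) (subset_itv_oo_cc ycd); near: n; exact: cutoff_eq1.
Unshelve. all: by end_near. Qed.

(** Dominated convergence with bound [|f|], applied on the open interval because every cutoff
    vanishes at [a] and [b]. *)
Lemma cvg_integral_cutoff f : a < b ->
  mu.-integrable `[a, b] (EFin \o f) ->
  \int[mu]_(x in `[a, b]) (f x * cutoff n x) @[n --> \oo]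
  --> \int[mu]_(x in `[a, b]) f x.
Proof.
move=> ab if_.
have ifo : mu.-integrable `]a, b[ (EFin \o f).
  by apply: integrableS if_ => //; exact: subset_itv_oo_cc.
have mf : measurable_fun `]a, b[ f.
  by apply/measurable_EFinP; exact: measurable_int ifo.
have mfn n : measurable_fun `]a, b[ (fun x => f x * cutoff n x).
  apply: measurable_funM => //.
  apply: (@measurable_funS _ _ _ _ setT) => //.
  apply: continuous_measurable_fun.
  exact: (smooth_continuous _ 0%N (smooth_cutoff n)).
have f_f : {ae mu, forall x, x \in `]a, b[ ->
    (f x * cutoff n x)%:E @[n --> \oo] --> (f x)%:E}.
  apply: aeW => x; rewrite in_itv/= => /andP[ax xb].
  apply: cvg_near_cst; near=> n; congr EFin.
  have := near (derive1n_cutoff 0%N (cst 1) x ax xb) n.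
  by rewrite /= mul1r => ->; rewrite ?mulr1//; near: n.
have f_g : {ae mu, forall x n, x \in `]a, b[ ->
    (`|(f x * cutoff n x)%:E| <= `|f x|%:E)%E}.
  apply: aeW => x n _; rewrite lee_fin normrM ler_piMr//.
  exact: cutoff_norm.
have [_ _ H] := @dominated_convergence _ _ _ mu `]a, b[%classic
  (measurable_itv _) (fun n x => (f x * cutoff n x)%:E) (EFin \o f)
  (fun x => `|f x|%:E) (fun n => (measurable_EFinP _ _).2 (mfn n))
  ((measurable_EFinP _ _).2 mf) f_f (integrable_norm ifo) f_g.
have oo h : measurable_fun `]a, b[ h ->
    \int[mu]_(x in `[a, b]) h x = \int[mu]_(x in `]a, b[) h x.
  move=> mh; rewrite /Rintegral integral_itv_bndoo//.
  exact/measurable_EFinP.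
rewrite oo//; under eq_fun do rewrite oo//.
apply: fine_cvg; rewrite fineK; last exact: integrable_fin_num.
exact: H.
Unshelve. all: by end_near. Qed.

End Cutoff.

(** * Uniqueness of distributional moments *)

Section DistributionalMoments.
Context {R : realType}.
Variables (N K : nat) (xi : nat -> R).
Hypothesis xi_lt : forall n : nat, (n <= K)%N -> xi n < xi n.+1.
Notation mu := (@lebesgue_measure R).
Let a := xi 0%N.
Let b := xi K.+1.

Lemma xi_inside (i : 'I_K) : a < xi i.+1 /\ xi i.+1 < b.
Proof.
have iK := ltn_ord i; split.
- apply: lt_le_trans (xi_lt _ (leq0n K)) _.
  by apply: (xi_le _ _ xi_lt); rewrite ltnS /= leqW.
- apply: lt_le_trans (xi_lt _ iK) _.
  by apply: (xi_le _ _ xi_lt); rewrite ltnS iK leqnn.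
Qed.

Lemma cvg_pairing_cutoff r (c : 'I_K -> 'I_N -> R) phi :
  pw_continuous K xi r -> smooth phi ->
  pairing xi r c (fun x => phi x * cutoff a b n x) @[n --> \oo]
  --> pairing xi r c phi.
Proof.
move=> cr sphi.
have /choice[s hs] : forall n, exists s : R -> R, (n <= K)%N ->
    {within `[xi n, xi n.+1], continuous s} /\
    (forall x, x \in `]xi n, xi n.+1[ -> r x = s x).
  move=> n; have [nK|nK] := leqP n K; last by exists r.
  by have [s cs rs] := cr n nK; exists s.
have ir : mu.-integrable `[a, b] (EFin \o (fun x => r x * phi x)).
  apply: (proj1 (integral_pieces _ _ _ (fun n x => s n x * phi x) xi_lt _ _)).
  - move=> n nK; apply: within_continuousM; first by case: (hs n nK).
    exact: (smooth_continuous _ 0%N sphi).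
  - by move=> n x nK xn; have [_ ->] := hs n nK.
have ab : a < b.
  apply: lt_le_trans (xi_lt _ (leq0n K)) _.
  by apply: (xi_le _ _ xi_lt); rewrite ltnS leqnn.
rewrite /pairing; apply: cvgD.
  have := cvg_integral_cutoff _ _ _ ab ir.
  by under eq_fun do under eq_Rintegral do rewrite -mulrA.
have near_der : \forall n \near \oo, forall (i : 'I_K) (l : 'I_N),
    derive1n l (fun x => phi x * cutoff a b n x) (xi i.+1)
    = derive1n l phi (xi i.+1).
  apply: filter_forall => i; apply: filter_forall => l.
  by have [ax xb] := xi_inside i; exact: derive1n_cutoff.
apply: cvg_near_cst; apply: filterS near_der => n der.
by apply: eq_bigr => i _; apply: eq_bigr => l _; rewrite der.
Qed.

(** For any decomposition, the pairing with [x^k] is the limit of [T] at [x^k] times the cutoffs,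
    which are test functions. This sequence depends on [T] alone, so the set under [xget] has a
    single element. *)
Lemma distr_moment_eq (T : functional) r (c : 'I_K -> 'I_N -> R) k :
  decomposes xi T r c ->
  distr_moment N K xi T k = pairing xi r c (fun x => x ^+ k).
Proof.
move=> rc; rewrite /distr_moment; apply: xget_subset1; first by exists r, c.
have sX : smooth (fun x : R => x ^+ k).
  by have := smooth_horner ('X^k : {poly R}); congr smooth;
    apply/funext => x; rewrite hornerXn.
have lim r' (c' : 'I_K -> 'I_N -> R) : decomposes xi T r' c' ->
    T (fun x => x ^+ k * cutoff a b n x) @[n --> \oo]
    --> pairing xi r' c' (fun x => x ^+ k).
  move=> [cr' h]; rewrite [X in X @ _ --> _](_ : _ = fun n =>
      pairing xi r' c' (fun x => x ^+ k * cutoff a b n x)).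
    exact: cvg_pairing_cutoff.
  by apply/funext => n; apply: h; exact: test_fun_cutoff.
move=> _ _ [r1 [c1 [/lim h1 ->]]] [r2 [c2 [/lim h2 ->]]].
exact: (cvg_unique _ h1 h2).
Qed.

End DistributionalMoments.

(** * Moments of polynomials *)

Section OpE.
Context {R : realType}.
Variable L : {poly R} -> R.
Hypothesis LD : forall p q, L (p + q) = L p + L q.
Hypothesis LZ : forall c p, L (c *: p) = c * L p.

(** On the moments of a linear functional the shift is multiplication by ['X], so subtracting [c]
    times the identity gives multiplication by ['X - c]. *)
Lemma shift_subE c q (s : nat -> R) : (forall k, s k = L (q * 'X^k)) ->
  forall k, shift_sub c s k = L (('X - c%:P) * q * 'X^k).
Proof.
move=> h k; rewrite /shift_sub /shift !h -mulNr -LZ -LD; congr L.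
by rewrite exprS -mul_polyC polyCN; ring.
Qed.

Lemma iter_shift_subE c n q (s : nat -> R) : (forall k, s k = L (q * 'X^k)) ->
  forall k, iter n (shift_sub c) s k = L (('X - c%:P) ^+ n * q * 'X^k).
Proof.
move=> h; elim: n => [|n IH] k; first by rewrite expr0 mul1r -h.
by rewrite iterS (shift_subE _ _ _ IH) exprS !mulrA.
Qed.

Lemma opE_E N (a b : R) q (s : nat -> R) : (forall k, s k = L (q * 'X^k)) ->
  forall k, opE N a b s k = L (end_factor N a b * q * 'X^k).
Proof.
move=> h k; rewrite /opE (iter_shift_subE a N (('X - b%:P) ^+ N * q)).
  by rewrite /end_factor !mulrA.
exact: iter_shift_subE.
Qed.

End OpE.

Section Moments.
Context {R : realType}.
Variables (N K : nat) (xi : nat -> R) (g : R -> R) (gp : nat -> R -> R).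
Hypothesis xi_lt : forall n : nat, (n <= K)%N -> xi n < xi n.+1.
Hypothesis g_pieces : pieced K xi g gp.
Hypothesis gp_CN : forall n : nat, (n <= K)%N -> CnI N (xi n) (xi n.+1) (gp n).
Notation mu := (@lebesgue_measure R).
Let a := xi 0%N.
Let b := xi K.+1.
Let E := end_factor N a b.

Definition poly_moment (q : {poly R}) : R :=
  \int[mu]_(x in `[a, b]) (g x * q.[x]).

Let integrable_g_poly (q : {poly R}) :
  mu.-integrable `[a, b] (EFin \o (fun x => g x * q.[x])).
Proof.
apply: (integrable_g_mul _ _ _ _ _ xi_lt g_pieces gp_CN).
exact: continuous_horner.
Qed.

Lemma poly_momentD p q : poly_moment (p + q) = poly_moment p + poly_moment q.
Proof.
rewrite /poly_moment -RintegralD//.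
by apply: eq_Rintegral => x _; rewrite hornerD mulrDr.
Qed.

Lemma poly_momentZ c p : poly_moment (c *: p) = c * poly_moment p.
Proof.
rewrite /poly_moment -RintegralZl//.
by apply: eq_Rintegral => x _; rewrite hornerZ mulrCA.
Qed.

(* Pairing of the j-th distributional derivative of g with q. *)
Definition deriv_moment (j : nat) (q : {poly R}) : R :=
  (-1) ^+ j * poly_moment q^`(j).

Lemma deriv_momentD j p q :
  deriv_moment j (p + q) = deriv_moment j p + deriv_moment j q.
Proof. by rewrite /deriv_moment derivnD poly_momentD mulrDr. Qed.

Lemma deriv_momentZ j c p : deriv_moment j (c *: p) = c * deriv_moment j p.
Proof. by rewrite /deriv_moment derivnZ poly_momentZ mulrCA. Qed.

Lemma deriv_moment_sum j n (q : 'I_n -> {poly R}) :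
  deriv_moment j (\sum_(i < n) q i) = \sum_(i < n) deriv_moment j (q i).
Proof.
apply: (big_morph (deriv_moment j) (deriv_momentD j)).
by rewrite -(scale0r 0) deriv_momentZ mul0r.
Qed.

(** The j-th derivative of ['X^l] is the falling factorial of [l] times ['X^(l - j)], so [opPi]
    lists the pairings of the j-th derivative of [g] with monomials. For [l < j] both sides are
    0. *)
Lemma vseqE i j k :
  vseq N a b (fun_moment a b g) i j k = deriv_moment j (E * 'X^(i + k)).
Proof.
rewrite /vseq (opE_E _ (deriv_momentD j) (deriv_momentZ j) N a b 'X^i).
  by rewrite -mulrA -exprD.
move=> l; rewrite /opPi /deriv_moment -exprD derivnXn -mulrA; congr (_ * _).
rewrite -(scaler_nat _ ('X^_)) poly_momentZ; congr (_ * _).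
by apply: eq_Rintegral => x _; rewrite hornerXn mulrC.
Qed.

Lemma deriv_moment_horner j (q : {poly R}) :
  deriv_moment j q =
  (-1) ^+ j * \int[mu]_(x in `[a, b]) (g x * derive1n j (horner q) x).
Proof. by rewrite derive1n_horner. Qed.

Lemma deriv_moment_factor j (p q : {poly R}) :
  deriv_moment j (p * q) = (-1) ^+ j * \int[mu]_(x in `[a, b])
    (g x * derive1n j (fun x => p.[x] * q.[x]) x).
Proof.
rewrite deriv_moment_horner; congr (_ * _).
suff -> : horner (p * q) = fun x => p.[x] * q.[x] by [].
by apply/funext => x; rewrite hornerM.
Qed.

(** The roots of [p] remove every boundary term. This applies to [E] alone when there is no jump,
    and to [E] times the jump factor in general. *)
Lemma deriv_moment_pieces j (p q : {poly R}) : (j <= N)%N ->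
  (forall n, (n <= K.+1)%N -> ('X - (xi n)%:P) ^+ N %| p) ->
  deriv_moment j (p * q) = \sum_(n < K.+1) \int[mu]_(x in `[xi n, xi n.+1])
    (derivIn (xi n) (xi n.+1) j (gp n) x * (p.[x] * q.[x])).
Proof.
move=> jN pxi; rewrite deriv_moment_factor.
rewrite (pieces_integration_by_parts _ _ _ _ _ xi_lt g_pieces gp_CN)//; last
  first.
  exact/smooth_poly_mul/smooth_horner.
by rewrite (jump_terms_eq0 N)// ?addr0//; exact: smooth_horner.
Qed.

Lemma iter_distr_deriv j (T : @functional R) phi :
  iter j distr_deriv T phi = (-1) ^+ j * T (derive1n j phi).
Proof.
elim: j phi => [|j IH] phi; first by rewrite expr0 mul1r.
by rewrite iterS /distr_deriv IH exprS mulN1r mulNr derive1Sn.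
Qed.

Lemma gfrak_momentE j k : (j <= N)%N ->
  gfrak_moment N K xi g j k = deriv_moment j (E * 'X^k).
Proof.
move=> jN; rewrite /gfrak_moment; case: eqP => K0.
  (* Without jumps the only break points are [a] and [b], where [E] already has roots of order
     [N]. *)
  have xiE n : (n <= K.+1)%N -> ('X - (xi n)%:P) ^+ N %| E.
    rewrite K0; case: n => [|[|//]] _; first exact: dvdp_mulIl.
    by rewrite /E /b K0; exact: dvdp_mulIr.
  rewrite deriv_moment_pieces// /fun_moment K0 big_ord_recl big_ord0 addr0.
  apply: eq_Rintegral => x; rewrite inE/= => x01.
  rewrite /gfrak_fun hornerXn mulrC -mulrA mulrCA; congr (_ * _).
    (* With no jump point to except, [g] and [gp 0] agree on the whole closed interval, as the
       one-sided derivatives at its ends require. *)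
    rewrite (@eq_derivIn _ _ _ _ _ (gp 0%N))// => y y01.
    apply: g_pieces => // i; rewrite K0 => /andP[i1 i0].
    by have := leq_trans i1 i0.
  by rewrite /E /b K0.
have [r [c [cr h]]] := gfrak_decomposition _ _ _ _ _ xi_lt g_pieces gp_CN j jN.
have sX : smooth (horner ('X^k : {poly R})) by exact: smooth_horner.
have hX : horner ('X^k : {poly R}) = fun x => x ^+ k.
  by apply/funext => x; rewrite hornerXn.
rewrite (distr_moment_eq _ _ _ xi_lt _ r c).
  by rewrite deriv_moment_factor -hX -h.
split=> // phi [sphi _]; rewrite -h//.
by rewrite /gfrak_distr /distr_scale iter_distr_deriv.
Qed.

End Moments.

(** * The recurrence *)

Section Annihilation.
Context {R : realType}.
Notation mu := (@lebesgue_measure R).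

Lemma dvdp_end_jump_factor N K (xi : nat -> R) n : (n <= K.+1)%N ->
  ('X - (xi n)%:P) ^+ N %|
    end_factor N (xi 0%N) (xi K.+1) * jump_factor N K xi.
Proof.
rewrite leq_eqVlt => /predU1P[->|]; first by rewrite dvdp_mulr// dvdp_mulIr.
case: n => [_|n nK]; first by rewrite dvdp_mulr// dvdp_mulIl.
rewrite dvdp_mull// /jump_factor (bigD1_seq n.+1) ?iota_uniq//=.
  exact: dvdp_mulIl.
by rewrite mem_index_iota.
Qed.

(** The product of the end and jump factors has a root of order [N] at every break point, so only
    integrals over pieces remain. Summed over [j], their integrands contain the operator applied to
    [gp n], which is 0. *)
Lemma sum_deriv_moment_eq0 N K (xi : nat -> R) g gp pdag k :
  (forall n : nat, (n <= K)%N -> xi n < xi n.+1) ->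
  pieced K xi g gp ->
  (forall n : nat, (n <= K)%N -> CnI N (xi n) (xi n.+1) (gp n)) ->
  (forall n : nat, (n <= K)%N ->
     annihilates_on pdag (xi n) (xi n.+1) (gp n)) ->
  \sum_(j < N.+1) deriv_moment K xi g j
    (end_factor N (xi 0%N) (xi K.+1) *
       (jump_factor N K xi * pdag j * 'X^k)) = 0.
Proof.
move=> xi_lt g_pieces gp_CN ann.
set E := end_factor _ _ _; set J := jump_factor _ _ _.
pose F n (j : 'I_N.+1) x := derivIn (xi n) (xi n.+1) j (gp n) x *
  ((E * J).[x] * (pdag j * 'X^k).[x]).
have cF n (j : 'I_N.+1) : (n <= K)%N ->
    {within `[xi n, xi n.+1], continuous (F n j)}.
  move=> nK; apply: within_continuousM.
    by apply: (gp_continuous _ _ _ _ gp_CN) => //; rewrite -ltnS.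
  suff -> : (fun x => (E * J).[x] * (pdag j * 'X^k).[x]) =
      horner ((E * J) * (pdag j * 'X^k)) by exact: continuous_horner.
  by apply/funext => x; rewrite [RHS]hornerM.
transitivity (\sum_(j < N.+1) \sum_(n < K.+1)
    \int[mu]_(x in `[xi n, xi n.+1]) F n j x).
  apply: eq_bigr => j _; have jN : (j <= N)%N by rewrite -ltnS.
  rewrite -(mulrA J) (mulrA E).
  exact: (deriv_moment_pieces _ _ _ _ _ xi_lt g_pieces gp_CN _ _ _ jN
    (dvdp_end_jump_factor N K xi)).
rewrite exchange_big/= big1// => n _; have nK : (n <= K)%N by rewrite -ltnS.
have iF (j : 'I_N.+1) : mu.-integrable `[xi n, xi n.+1] (EFin \o F n j).
  apply: continuous_compact_integrable; first exact: segment_compact.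
  exact: cF.
rewrite -(proj2 (Rintegral_sum mu _ _ _ (measurable_itv _) iF)).
transitivity (\int[mu]_(x in `[xi n, xi n.+1]) (cst 0 x : R)); last first.
  by rewrite Rintegral_cst// mul0r.
apply: eq_Rintegral => x.
rewrite inE/= => xn; transitivity ((E * J).[x] * ('X^k : {poly R}).[x] *
    \sum_(j < N.+1) (pdag j).[x] * derivIn (xi n) (xi n.+1) j (gp n) x).
  rewrite mulr_sumr; apply: eq_bigr => j _.
  by rewrite /F (hornerM (pdag j)); ring.
by rewrite ann ?mulr0.
Qed.

(** * Polynomial coefficients and products with reversed polynomials *)

Lemma sum_coefX_le n (q : {poly R}) : (size q <= n)%N ->
  \sum_(i < n) q`_i *: 'X^i = q.
Proof.
move=> qn; rewrite -poly_def; apply/polyP => i; rewrite coef_poly.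
by case: ltnP => // ni; rewrite nth_default// (leq_trans qn).
Qed.

(** The coefficient of [q] at [i] meets [f l] exactly when [n - l = d - i], that is
    [l = i + (n - d)]; the bounds [e <= d <= n] keep these truncated subtractions exact. *)
Lemma fps_mul_revpolyE d e (f : nat -> R) (q : {poly R}) n :
  (e <= d)%N -> (d <= n)%N ->
  fps_mul f (fps_poly (revpoly d e q)) n =
  \sum_(i < e.+1) f (i + (n - d))%N * q`_i.
Proof.
move=> ed dn; rewrite /fps_mul /fps_poly.
transitivity (\sum_(i < e.+1) \sum_(l < n.+1)
    f l * (q`_i * (n - l == d - i)%N%:R)).
  rewrite exchange_big/=; apply: eq_bigr => l _.
  rewrite /revpoly coef_sum mulr_sumr; apply: eq_bigr => i _.
  by rewrite coefZ coefXn.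
apply: eq_bigr => i _; have ie := ltn_ord i.
have lt_l : (i + (n - d) < n.+1)%N by lia.
rewrite (bigD1 (Ordinal lt_l))//= big1 ?addr0 => [|l].
  by rewrite (_ : _ == _ = true) ?mulr1//; apply/eqP; lia.
rewrite -val_eqE/= => /eqP l_neq; have ln := ltn_ord l.
by rewrite (_ : _ == _ = false) ?mulr0//; apply/eqP; lia.
Qed.

End Annihilation.

Theorem theorem3p1 (R : realType) (N K : nat) (a b : R) (xi : nat -> R)
    (g : R -> R) (gp : nat -> R -> R)
    (pdag p : 'I_N.+1 -> {poly R}) (kd : 'I_N.+1 -> nat) (m : nat -> R)
    (v : nat -> nat -> nat -> R) (h : nat -> nat -> R)
    (N_ge1 : (1 <= N)%N)
    (xi0 : xi 0%N = a) (xiK : xi K.+1 = b)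
    (xi_lt : forall n : nat, (n <= K)%N -> xi n < xi n.+1)
    (g_pieces : pieced K xi g gp)
    (gp_CN : forall n : nat, (n <= K)%N -> CnI N (xi n) (xi n.+1) (gp n))
    (lead_neq0 : forall x : R, x \in `[a, b] -> (pdag ord_max).[x] != 0)
    (gp_annihilated : forall n : nat, (n <= K)%N ->
       annihilates_on pdag (xi n) (xi n.+1) (gp n))
    (p_def : forall j : 'I_N.+1, p j = jump_factor N K xi * pdag j)
    (kd_size : forall j : 'I_N.+1, (size (p j) <= (kd j).+1)%N)
    (m_def : m = fun_moment a b g)
    (v_def : v = vseq N a b m)
    (h_def : h = fun j : nat => v 0%N j) :
  [/\ (* (A) *)
      forall M : nat,
        (\mxrow_(j < N.+1) \matrix_(k < M.+1, i < (kd j).+1) v i j k)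
        *m (\mxcol_(j < N.+1) \col_(i < (kd j).+1) (p j)`_i) = 0,
      (* (B) *)
      (forall (j : 'I_N.+1) (i k : nat), (i <= kd j)%N ->
         v i j k = gfrak_moment N K xi g j (i + k))
      /\ (forall j : 'I_N.+1, h j =1 gfrak_moment N K xi g j)
    & (* (C) *)
      let d := (\max_(j < N.+1) kd j)%N in
      exists q : {poly R}, (size q <= d)%N /\
        forall n : nat,
          fps_poly q n
          + \sum_(j < N.+1)
              fps_mul (h j) (fps_poly (revpoly d (kd j) (p j))) n = 0].
Proof.
have vE i j k : v i j k =
    deriv_moment K xi g j (end_factor N (xi 0%N) (xi K.+1) * 'X^(i + k)).
  by rewrite v_def m_def -xi0 -xiK (vseqE _ _ _ _ _ xi_lt g_pieces gp_CN).
(* This is row [k] of the linear system; it yields (A) and the coefficients of degree at least [d]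
   in (C). *)
have row_eq0 k : \sum_(j < N.+1) \sum_(i < (kd j).+1) v i j k * (p j)`_i = 0.
  rewrite -[RHS](sum_deriv_moment_eq0 _ _ _ _ _ _ k xi_lt g_pieces gp_CN
    gp_annihilated).
  (* As [kd j] only bounds the degree of [p j], this expansion may contain trailing zero
     coefficients. *)
  apply: eq_bigr => j _; rewrite -p_def -[in RHS](sum_coefX_le _ _ (kd_size j)).
  rewrite mulr_suml mulr_sumr.
  rewrite (deriv_moment_sum _ _ _ _ _ xi_lt g_pieces gp_CN).
  apply: eq_bigr => i _; rewrite vE mulrC.
  rewrite -(deriv_momentZ _ _ _ _ _ xi_lt g_pieces gp_CN).
  by rewrite -scalerAl -scalerAr exprD.
have vB (j : 'I_N.+1) i k : v i j k = gfrak_moment N K xi g j (i + k).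
  by rewrite vE (gfrak_momentE _ _ _ _ _ xi_lt g_pieces gp_CN)// -ltnS.
split=> [M||d].
- apply/matrixP => k z; rewrite mul_mxrow_mxcol summxE mxE -[RHS](row_eq0 k).
  apply: eq_bigr => j _; rewrite mxE; apply: eq_bigr => i _.
  by rewrite !mxE.
- by split=> [j i k _|j k]; rewrite ?h_def vB.
- pose S n := \sum_(j < N.+1)
    fps_mul (h j) (fps_poly (revpoly d (kd j) (p j))) n.
  (* The polynomial cancels the coefficients of [S] below [d]; from [d] on, coefficient [n] of [S]
     is row [n - d] and vanishes by itself. *)
  exists (\poly_(n < d) - S n); split=> [|n]; first exact: size_poly.
  rewrite {1}/fps_poly coef_poly; case: ltnP => dn; first by rewrite addNr.
  rewrite add0r -[RHS](row_eq0 (n - d)%N); apply: eq_bigr => j _.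
  rewrite fps_mul_revpolyE//; last exact: leq_bigmax.
  by apply: eq_bigr => i _; rewrite h_def !vE.
Qed.
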